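(* Consider a GMCLP instance $(\mathcal{I},\mathcal{J},(\mathcal{I}_j)_{j\in\mathcal{J}},(w_j)_{j\in\mathcal{J}},p)$ with $\mathcal{N}=\{j\in\mathcal{J}: w_j<0\}$. Let (T) be the problem obtained from the GMCLP formulation (F) by adding the inequalities $$x_j\le x_r+y(\mathcal{I}_j\setminus\mathcal{I}_r)\qquad\text{for all } j,r\in\mathcal{J}\text{ with } j\ne r,$$ and let (T$^{+-}$) be the problem obtained from (F) by adding only the inequalities $$x_j\le x_r+y(\mathcal{I}_j\setminus\mathcal{I}_r)\qquad\text{for all } j\in\mathcal{J}\setminus\mathcal{N},\ r\in\mathcal{N}.$$ Then the LP relaxations of (T) and (T$^{+-}$) have the same optimal value.
   Context: A GMCLP (generalized maximal covering location problem) instance consists of finite nonempty sets $\mathcal{I}$ (candidate facility locations) and $\mathcal{J}$ (customers), subsets $\mathcal{I}_j\subseteq\mathcal{I}$ for $j\in\mathcal{J}$, real weights $w_j$ for $j\in\mathcal{J}$ (positive or negative), and an integer $p$ with $1\le p\le|\mathcal{I}|$. Put $\mathcal{N}=\{j\in\mathcal{J}: w_j<0\}$. For a vector $a$ and a subset $\mathcal{S}$ of its index set, $a(\mathcal{S})=\sum_{i\in\mathcal{S}}a_i$. The GMCLP formulation (F) is: maximize $\sum_{j\in\mathcal{J}}w_jx_j$ subject to $y(\mathcal{I})=p$; $y(\mathcal{I}_j)\ge x_j$ for all $j\in\mathcal{J}\setminus\mathcal{N}$; $x_j\ge y_i$ for all $j\in\mathcal{N}$, $i\in\mathcal{I}_j$;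 $x_j\in\{0,1\}$ for all $j\in\mathcal{J}$; $y_i\in\{0,1\}$ for all $i\in\mathcal{I}$. The LP relaxation of (F), or of (F) with additional linear inequalities, is obtained by replacing $\{0,1\}$ by $[0,1]$ for all variables. *)

(* Defs.v *)
From mathcomp Require Import all_boot all_order all_algebra.
From mathcomp Require Import boolp classical_sets set_interval reals.

Set Implicit Arguments.
Unset Strict Implicit.
Unset Printing Implicit Defensive.

Import Order.TTheory GRing.Theory Num.Theory.

Local Open Scope ring_scope.

(* The nonemptiness of [I] is stated for the record; it follows from the bounds
   on [nfac].  Zero weights are allowed and count as nonnegative. *)
Record gmclp (R : realType) (I J : finType) := Gmclp {
  cover : J -> {set I};
  weight : J -> R;
  nfac : nat;
  facilities_neq0 : (0 < #|I|)%N;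
  customers_neq0 : (0 < #|J|)%N;
  nfac_bounds : (1 <= nfac <= #|I|)%N }.

Section Formulation.
Variables (R : realType) (I J : finType) (G : gmclp R I J).
Implicit Types (x : J -> R) (y : I -> R).

Definition negative : {set J} := [set j | weight G j < 0]%SET.

Definition total y (S : {set I}) : R := \sum_(i in S) y i.

Definition objective x : R := \sum_j weight G j * x j.

Definition constraints_F x y : Prop :=
  [/\ total y [set: I]%SET = (nfac G)%:R,
      forall j, j \notin negative -> x j <= total y (cover G j) &
      forall j i, j \in negative -> i \in cover G j -> y i <= x j].

Definition cut j r x y : Prop :=
  x j <= x r + total y (cover G j :\: cover G r)%SET.

Definition cuts_T x y : Prop := forall j r, j != r -> cut j r x y.

Definition cuts_Tpm x y : Prop :=
  forall j r, j \notin negative -> r \in negative -> cut j r x y.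

(* Feasibility for (F) strengthened by the inequalities [cuts], all variables
   ranging over [D]: the 0-1 problem is the case D = {0, 1}, and its LP
   relaxation the case D = [0, 1]. *)
Definition feasible (D : set R) (cuts : (J -> R) -> (I -> R) -> Prop) x y :
    Prop :=
  [/\ constraints_F x y, cuts x y, forall j, D (x j) & forall i, D (y i)].

Definition values (D : set R) (cuts : (J -> R) -> (I -> R) -> Prop) : set R :=
  [set v | exists x y, feasible D cuts x y /\ objective x = v]%classic.

(* The optimal value is an attained maximum, so that it exists only if the
   problem is feasible and bounded. *)
Definition is_optimal_value (D : set R)
    (cuts : (J -> R) -> (I -> R) -> Prop) (v : R) : Prop :=
  values D cuts v /\ ubound (values D cuts) v.

Definition is_lp_optimal_value (cuts : (J -> R) -> (I -> R) -> Prop) (v : R) :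
    Prop :=
  is_optimal_value `[0, 1]%classic cuts v.

End Formulation.

(* Main.v *)
Require Import Defs.
From mathcomp Require Import all_boot all_order all_algebra.
From mathcomp Require Import boolp classical_sets set_interval reals.
From mathcomp Require Import topology normedtype derive.
From mathcomp Require Import lra.

(** The two relaxations share their y-variables, and every point of (T) is a
    point of (T+-), so two things are needed: (T+-) attains a maximum, and every
    point of (T+-) can be turned into a point of (T) that is at least as good.

    Attainment is compactness: the feasible set of (T+-) is a closed part of a
    cube, and it contains the point where all facilities are open to the degree
    p / |I|, the customers of negative weight are served and the others are not.

    For the repair, fix y and read d j r = y (I_j \ I_r) as a distance between
    customers.  It is not symmetric, but it vanishes on the diagonal and obeys
    the triangle inequality because y >= 0.  The cut for (j, r) then says that x
    is 1-Lipschitz from r to j, and the task is to make x Lipschitz everywhere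
    when it is only so from N to its complement.  This is McShane's extension
    problem, with the bounds of (F) as further constraints.  Let [lower_ext] be
    the least nonnegative Lipschitz function that is at least x outside N and at
    least y_i at every customer covered by i; on N it lies below x.  Let
    [upper_ext] be the greatest Lipschitz function that is at most 1, at most
    y (I_j) at every j, and at most [lower_ext] on N.  Since [lower_ext] meets
    all these conditions, it lies below [upper_ext].  So [upper_ext] is at least
    x outside N and at most x on N, which can only improve the objective; and
    being Lipschitz it satisfies all the cuts of (T). *)

Set Implicit Arguments.
Unset Strict Implicit.
Unset Printing Implicit Defensive.

Import Order.TTheory GRing.Theory Num.Theory.
Import numFieldNormedType.Exports.

Local Open Scope ring_scope.

(** * Repairing the cuts for fixed facility values *)

Section Instance.
Variables (R : realType) (I J : finType) (G : gmclp R I J).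
Implicit Types (x : J -> R) (y : I -> R) (A B C : {set I}).

(* The bare names denote the totality of a relation and the union of a family
   of sets. *)
Local Notation total := Defs.total.
Local Notation cover := Defs.cover.

Definition gap y j r : R := total y (cover G j :\: cover G r)%SET.

(** For [j] in N, the range, (F) and the cuts of (T+-) force each of these terms
    to be at most x_j; the formula is used for every customer. *)
Definition lower_ext x y j : R :=
  Num.max (\big[Num.max/0]_(i in cover G j) y i)
          (\big[Num.max/0]_(k | k \notin negative G) (x k - gap y k j)).

Definition upper_ext x y j : R :=
  Num.min (total y (cover G j))
          (\big[Num.min/1]_(n in negative G) (lower_ext x y n + gap y j n)).

Lemma lower_ext_leP x y j c :
  reflect [/\ 0 <= c, forall i, i \in cover G j -> y i <= c &
            forall k, k \notin negative G -> x k <= c + gap y k j]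
          (lower_ext x y j <= c).
Proof.
rewrite /lower_ext ge_max; apply: (iffP andP).
  move=> [/bigmax_leP[c0 yc] /bigmax_leP[_ xc]]; split=> // k Nk.
  by rewrite -lerBlDr xc.
move=> [c0 yc xc]; split; apply/bigmax_leP; split=> // k Nk.
by rewrite lerBlDr xc.
Qed.

Lemma le_upper_extP x y j c :
  reflect [/\ c <= total y (cover G j), c <= 1 &
            forall n, n \in negative G -> c <= lower_ext x y n + gap y j n]
          (c <= upper_ext x y j).
Proof.
rewrite /upper_ext le_min; apply: (iffP andP).
  move=> [cy cmin]; split=> //; first exact: le_trans cmin (bigmin_le_id _ _ _ _).
  by move=> n Nn; apply: le_trans cmin _; exact: bigmin_le_cond.
by move=> [cy c1 cn]; split=> //; apply: le_bigmin.
Qed.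

Section NonnegativeFacilities.
Variable y : I -> R.
Hypothesis y_ge0 : forall i, 0 <= y i.

Lemma total_leU A B C :
  A \subset B :|: C -> total y A <= total y B + total y C.
Proof.
move=> /fintype.subsetP sA; rewrite /total.
rewrite [X in X <= _]big_mkcond [X in _ <= X + _]big_mkcond.
rewrite [X in _ <= _ + X]big_mkcond -big_split /=; apply: ler_sum => i _.
move: (sA i) (y_ge0 i); rewrite inE.
by case: (i \in A) => [/(_ isT)|_]; case: (i \in B); case: (i \in C) => //=; lra.
Qed.

Lemma le_total_facility A i : i \in A -> y i <= total y A.
Proof.
by move=> iA; rewrite /total (bigD1 i) //= lerDl sumr_ge0.
Qed.

Lemma total_ge0 A : 0 <= total y A.
Proof. by rewrite /total sumr_ge0. Qed.

Lemma gap_refl j : gap y j j = 0.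
Proof. by rewrite /gap /total finset.setDv big_set0. Qed.

Lemma gap_triangle j k l : gap y j l <= gap y j k + gap y k l.
Proof.
apply: total_leU; apply/fintype.subsetP => i; rewrite !inE.
by case: (i \in cover G j); case: (i \in cover G k); case: (i \in cover G l).
Qed.

Lemma total_cover_le_gap j k :
  total y (cover G j) <= total y (cover G k) + gap y j k.
Proof.
rewrite addrC; apply: total_leU; apply/fintype.subsetP => i; rewrite !inE.
by case: (i \in cover G j); case: (i \in cover G k).
Qed.

(** Each term of the maximum is Lipschitz: a facility of [j] is one of [r] or
    is counted in the gap, and the other terms follow the triangle inequality. *)
Lemma lower_ext_lipschitz x j r :
  lower_ext x y j <= lower_ext x y r + gap y j r.
Proof.
have /lower_ext_leP[L0 Ly Lx] := lexx (lower_ext x y r).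
have d0 := total_ge0 (cover G j :\: cover G r)%SET.
rewrite -[total _ _]/(gap y j r) in d0.
apply/lower_ext_leP; split=> [|i ij|k Nk]; first exact: addr_ge0.
  have [ir|nir] := boolP (i \in cover G r).
    by have := Ly _ ir; lra.
  have : y i <= gap y j r by apply: le_total_facility; rewrite inE nir.
  by lra.
by have := Lx _ Nk; have := gap_triangle k j r; lra.
Qed.

Lemma upper_ext_lipschitz x j r :
  upper_ext x y j <= upper_ext x y r + gap y j r.
Proof.
have /le_upper_extP[Uy U1 Un] := lexx (upper_ext x y j).
have d0 := total_ge0 (cover G j :\: cover G r)%SET.
rewrite -[total _ _]/(gap y j r) in d0.
rewrite -lerBlDr; apply/le_upper_extP; split=> [||n Nn].
- by have := total_cover_le_gap j r; lra.
- by lra.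
by have := Un _ Nn; have := gap_triangle j r n; lra.
Qed.

End NonnegativeFacilities.

Section Repair.
Variables (x : J -> R) (y : I -> R).
Hypothesis xy_feasible : feasible G `[0, 1]%classic (cuts_Tpm G) x y.

Let y_ge0 i : 0 <= y i.
Proof.
by case: xy_feasible => _ _ _ /(_ i); rewrite /= in_itv /= => /andP[].
Qed.

Let y_le1 i : y i <= 1.
Proof.
by case: xy_feasible => _ _ _ /(_ i); rewrite /= in_itv /= => /andP[].
Qed.

Let x_ge0 j : 0 <= x j.
Proof.
by case: xy_feasible => _ _ /(_ j) + _; rewrite /= in_itv /= => /andP[].
Qed.

Let x_le1 j : x j <= 1.
Proof.
by case: xy_feasible => _ _ /(_ j) + _; rewrite /= in_itv /= => /andP[].
Qed.

(** The three bounds that define [lower_ext] at [n] are, in this order, the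
    range, the constraints of (F) at [n] and the cuts of (T+-) into [n]. *)
Lemma lower_ext_le_negative n : n \in negative G -> lower_ext x y n <= x n.
Proof.
move=> Nn; have [[_ _ Fn] cuts _ _] := xy_feasible.
apply/lower_ext_leP; split=> [//|i|k Nk]; first exact: Fn.
exact: cuts.
Qed.

Lemma le_lower_ext j : j \notin negative G -> x j <= lower_ext x y j.
Proof.
have /lower_ext_leP[_ _ Lx] := lexx (lower_ext x y j).
by move=> /Lx; rewrite gap_refl addr0.
Qed.

(** [lower_ext] meets the bounds by its own values on N because it is Lipschitz.
    It is at most y (I_j) because this bound is itself Lipschitz in [j] and (F)
    keeps x below it outside N. *)
Lemma lower_le_upper_ext j : lower_ext x y j <= upper_ext x y j.
Proof.
have [[_ Fp _] _ _ _] := xy_feasible.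
apply/le_upper_extP; split=> [||n _]; last exact: lower_ext_lipschitz.
  apply/lower_ext_leP; split=> [|i|k Nk]; first exact: total_ge0.
    exact: le_total_facility.
  exact: le_trans (Fp _ Nk) (total_cover_le_gap _ _ _).
apply/lower_ext_leP; split=> // k _.
by have := x_le1 k; have := total_ge0 y_ge0 (cover G k :\: cover G j)%SET;
  rewrite /gap; lra.
Qed.

Lemma upper_ext_le_negative n : n \in negative G -> upper_ext x y n <= x n.
Proof.
move=> Nn; apply: le_trans (lower_ext_le_negative Nn).
have /le_upper_extP[_ _ /(_ _ Nn)] := lexx (upper_ext x y n).
by rewrite gap_refl addr0.
Qed.

Lemma upper_ext_feasible :
  feasible G `[0, 1]%classic (cuts_T G) (upper_ext x y) y.
Proof.
have [[Fy _ _] _ _ y01] := xy_feasible.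
have L_ge j : [/\ 0 <= lower_ext x y j,
    forall i, i \in cover G j -> y i <= lower_ext x y j & _] :=
  elimT (lower_ext_leP _ _ _ _) (lexx (lower_ext x y j)).
have U_le j : [/\ upper_ext x y j <= total y (cover G j),
    upper_ext x y j <= 1 & _] :=
  elimT (le_upper_extP _ _ _ _) (lexx (upper_ext x y j)).
split=> //.
- split=> // [j _|j i _ ij]; first by case: (U_le j).
  by case: (L_ge j) => _ /(_ i ij) yL _; exact: le_trans yL (lower_le_upper_ext j).
- by move=> j r _; exact: upper_ext_lipschitz.
- move=> j; rewrite /= in_itv /=; have [_ -> _] := U_le j; rewrite andbT.
  by have [L0 _ _] := L_ge j; exact: le_trans L0 (lower_le_upper_ext j).
Qed.

Lemma objective_le_upper_ext : objective G x <= objective G (upper_ext x y).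
Proof.
apply: ler_sum => j _; have [Nj|Nj] := boolP (j \in negative G).
  rewrite ler_wnM2l ?upper_ext_le_negative //.
  by move: Nj; rewrite inE => /ltW.
rewrite ler_wpM2l ?(le_trans (le_lower_ext Nj)) ?lower_le_upper_ext //.
by move: Nj; rewrite inE -leNgt.
Qed.

End Repair.

(** * The relaxation of (T+-) attains its maximum *)

Lemma relaxation_Tpm_nonempty :
  exists x y, feasible G `[0, 1]%classic (cuts_Tpm G) x y.
Proof.
have I_gt0 : 0 < #|I|%:R :> R by rewrite ltr0n (facilities_neq0 G).
have /andP[_ p_le] := nfac_bounds G.
pose c : R := (nfac G)%:R / #|I|%:R.
have c_ge0 : 0 <= c by rewrite divr_ge0 // ?ler0n.
have c_le1 : c <= 1 by rewrite ler_pdivrMr // mul1r ler_nat.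
exists (fun j => (j \in negative G)%:R), (fun=> c); split.
- split=> [|j /negbTE ->|j i -> _] //.
    by rewrite /total sumr_const cardsT -(mulr_natr c) divfK // gt_eqF.
  exact: total_ge0.
- move=> j r /negbTE Nj Nr; rewrite /cut Nj Nr addr_ge0 //.
  exact: total_ge0.
- by move=> j; rewrite /= in_itv /=; case: (_ \in _); rewrite ?lexx ?ler01.
- by move=> i; rewrite /= in_itv /= c_ge0.
Qed.

Lemma closed_le_fun (T : topologicalType) (f g : T -> R) :
  continuous f -> continuous g -> closed [set t | f t <= g t]%classic.
Proof.
move=> cf cg.
rewrite [X in closed X](_ : _ = (g \- f) @^-1` [set u | 0 <= u])%classic.
  apply: closed_comp (@closed_ge R 0) => t _.
  by apply: cvgB; [exact: cg|exact: cf].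
by apply/funext => t /=; rewrite subr_ge0.
Qed.

Lemma closed_forall (T : topologicalType) (K : Type) (P : K -> Prop)
    (F : K -> set T) :
  (forall k, P k -> closed (F k)) ->
  closed [set t | forall k, P k -> F k t]%classic.
Proof. exact: closed_bigI. Qed.

Lemma continuous_sumr (T : topologicalType) (K : finType) (P : pred K)
    (F : K -> T -> R) :
  (forall k, continuous (F k)) -> continuous (fun t => \sum_(k | P k) F k t).
Proof.
move=> cF; apply: continuous_big => // -[u v] /=.
exact: add_continuous.
Qed.

(** A point [(x, y)] is encoded as one function on the sum type, so that the
    cube is compact by Tychonoff's theorem. *)
Local Notation point := (prod_topology (fun _ : J + I => R)).

Let xpart (z : point) : J -> R := fun j => z (inl j).
Let ypart (z : point) : I -> R := fun i => z (inr i).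

Let xpart_continuous j : continuous (xpart^~ j).
Proof. exact: (@proj_continuous _ (fun _ : J + I => R) (inl j)). Qed.

Let ypart_continuous i : continuous (ypart^~ i).
Proof. exact: (@proj_continuous _ (fun _ : J + I => R) (inr i)). Qed.

Let total_continuous A : continuous (fun z => total (ypart z) A).
Proof. by apply: continuous_sumr => i; exact: ypart_continuous. Qed.

Let objective_continuous : continuous (fun z => objective G (xpart z)).
Proof.
apply: continuous_sumr => j z.
exact: (cvgM (cvg_cst (weight G j)) (@xpart_continuous j z)).
Qed.

Let closed_constraints_F :
  closed [set z : point | constraints_F G (xpart z) (ypart z)]%classic.
Proof.
rewrite [X in closed X](_ : _ =
    [set z | total (ypart z) [set: I]%SET = (nfac G)%:R] `&`
    ([set z | forall j, j \notin negative G ->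
        xpart z j <= total (ypart z) (cover G j)] `&`
     [set z | forall j, j \in negative G -> forall i, i \in cover G j ->
        ypart z i <= xpart z j]))%classic; last first.
  apply/seteqP; split => z /=.
    by case=> ? ? F3; split=> //; split=> // *; exact: F3.
  by case=> ? [? F3]; split=> // *; exact: F3.
apply: closedI; last apply: closedI.
- apply: (@closed_comp _ _ (fun z : point => total (ypart z) [set: I]%SET)
    [set u | u = (nfac G)%:R]%classic).
    by move=> z _; exact: total_continuous.
  exact: closed_eq.
- by apply: closed_forall => j _; exact: closed_le_fun.
- do 2![apply: closed_forall => ? _]; exact: closed_le_fun.
Qed.

Let closed_cuts_Tpm :
  closed [set z : point | cuts_Tpm G (xpart z) (ypart z)]%classic.
Proof.
rewrite [X in closed X](_ : _ =
    [set z | forall j, j \notin negative G -> forall r, r \in negative G ->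
       xpart z j <= xpart z r + gap (ypart z) j r])%classic; last first.
  by apply/seteqP; split => z H j r *; apply: H.
do 2![apply: closed_forall => ? _]; apply: closed_le_fun => // z.
exact: (cvgD (@xpart_continuous _ z) (@total_continuous _ z)).
Qed.

Lemma relaxation_Tpm_attained : exists v, is_lp_optimal_value G (cuts_Tpm G) v.
Proof.
pose cube : set point := [set z | forall k, `[0, 1]%classic (z k)]%classic.
pose polytope : set point :=
  ([set z | constraints_F G (xpart z) (ypart z)] `&`
   [set z | cuts_Tpm G (xpart z) (ypart z)] `&` cube)%classic.
have cube_compact : compact cube.
  exact: (@tychonoff (J + I)%type (fun=> R) (fun=> `[0, 1]%classic)
    (fun=> @segment_compact R 0 1)).
have polytope_compact : compact polytope.
  apply: (subclosed_compact _ cube_compact); last exact: subIsetr.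
  apply: closedI; first exact: closedI.
  apply: compact_closed cube_compact.
  by apply: hausdorff_product => _; exact: Rhausdorff.
have polytopeP z : polytope z <->
    feasible G `[0, 1]%classic (cuts_Tpm G) (xpart z) (ypart z).
  split=> [[[Fz cz] z01]|[Fz cz x01 y01]].
    by split=> // k; exact: z01.
  by split=> // -[j|i]; [exact: x01|exact: y01].
pose join x y : point := fun k => match k with inl j => x j | inr i => y i end.
have [x0 [y0 feas0]] := relaxation_Tpm_nonempty.
have polytope0 : (polytope !=set0)%classic.
  by exists (join x0 y0); apply/polytopeP.
have [z zP zmax] := compact_EVT_max polytope0 polytope_compact
  (continuous_subspaceT objective_continuous).
exists (objective G (xpart z)); split.
  exists (xpart z), (ypart z); split=> //; apply/polytopeP.
  by rewrite inE in zP.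
move=> _ [x [y [feas <-]]]; apply: (zmax (join x y)).
by rewrite inE; apply/polytopeP.
Qed.

End Instance.

(** * Equality of the optimal values *)

Theorem theorem5p2 (R : realType) (I J : finType) (G : gmclp R I J) :
  exists v : R,
    is_lp_optimal_value G (cuts_T G) v /\ is_lp_optimal_value G (cuts_Tpm G) v.
Proof.
have [v [[x [y [feas objE]]] vmax]] := relaxation_Tpm_attained G.
have T_le_Tpm x' y' : feasible G `[0, 1]%classic (cuts_T G) x' y' ->
    objective G x' <= v.
  move=> [F' cuts' x01 y01]; apply: vmax; exists x', y'; split=> //; split=> //.
  move=> j r Nj Nr; apply: cuts'.
  by apply: contraNneq Nj => ->.
exists v; split; last by split=> //; exists x, y.
split; last by move=> _ [x' [y' [feas' <-]]]; exact: T_le_Tpm feas'.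
have feasU := upper_ext_feasible feas.
exists (upper_ext G x y), y; split=> //; apply/le_anti.
by rewrite (T_le_Tpm _ _ feasU) -objE objective_le_upper_ext.
Qed.
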